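(* For $i=1, 2, \ldots, p$, assume $G_i$ is a graph and $f_i:V(G_i) \to \mathbb{N}$ is a mapping which assigns to each vertex $v$ of $G_i$ a positive integer $f_i(v)$. Then $$m_c(G_1\cup G_2 \cup \cdots \cup G_p ,f_1\cup f_2 \cup \cdots \cup f_p)=\prod_{i=1}^pm_c(G_i, f_i),$$ $$m_p(G_1\cup G_2 \cup \cdots \cup G_p ,f_1\cup f_2 \cup \cdots \cup f_p)=\prod_{i=1}^pm_p(G_i, f_i).$$
   Context: $G_1\cup\cdots\cup G_p$ is the vertex-disjoint union and $f_1\cup\cdots\cup f_p$ is the mapping equal to $f_i$ on $V(G_i)$. For graphs $G,H$, the join $G \vee H$ is obtained from the disjoint union of $G$ and $H$ by adding all edges between $V(G)$ and $V(H)$; $\overline{K_m}$ is the edgeless graph on $m$ vertices. For a graph $G$ and $f:V(G)\to\mathbb{N}$, $f^{(m)}$ is the extension of $f$ to $G \vee \overline{K_m}$ with $f^{(m)}(v)=|V(G)|$ for each vertex $v$ of $\overline{K_m}$; $m_c(G,f)$ (resp. $m_p(G,f)$) is the minimum $m$ such that $G \vee \overline{K_m}$ is not $f^{(m)}$-choosable (resp. not $f^{(m)}$-paintable), with values possibly $\infty$ if no such $m$ exists in the choosability sense. *)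

(* Defs.v *)
From HB Require Import structures.
From mathcomp Require Import all_boot finmap boolp.

Set Implicit Arguments.
Unset Strict Implicit.
Unset Printing Implicit Defensive.

Record sgraph := SGraph {
  vertex :> finType;
  adj : rel vertex;
  adj_sym : symmetric adj;
  adj_irrefl : irreflexive adj }.

Definition edgeless_adj (m : nat) : rel 'I_m := fun _ _ => false.

Lemma edgeless_adj_sym m : symmetric (@edgeless_adj m).
Proof. by []. Qed.

Lemma edgeless_adj_irrefl m : irreflexive (@edgeless_adj m).
Proof. by []. Qed.

Definition edgeless (m : nat) : sgraph :=
  SGraph (@edgeless_adj_sym m) (@edgeless_adj_irrefl m).

Section Join.
Variables G H : sgraph.

Definition join_adj (x y : G + H) : bool :=
  match x, y with
  | inl u, inl v => adj u v
  | inr u, inr v => adj u v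
  | _, _ => true
  end.

Lemma join_adj_sym : symmetric join_adj.
Proof. by move=> [u|u] [v|v] //=; rewrite adj_sym. Qed.

Lemma join_adj_irrefl : irreflexive join_adj.
Proof. by move=> [u|u] /=; rewrite adj_irrefl. Qed.

Definition join : sgraph := SGraph join_adj_sym join_adj_irrefl.
End Join.

Section DisjointUnion.
Variables (p : nat) (G : 'I_p -> sgraph).

(* When the tags agree, [tagged_as x y] is the second component of [y] cast to
   the vertex type of the graph containing [x]. *)
Definition dunion_adj (x y : {i : 'I_p & G i}) : bool :=
  (tag x == tag y) && adj (tagged x) (tagged_as x y).

Lemma dunion_adj_sym : symmetric dunion_adj.
Proof.
move=> [i u] [j v]; rewrite /dunion_adj /=.
case: (eqVneq i j) => //= eq_ij; case: j / eq_ij v => v.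
by rewrite !tagged_asE adj_sym.
Qed.

Lemma dunion_adj_irrefl : irreflexive dunion_adj.
Proof. by move=> [i u]; rewrite /dunion_adj /= tagged_asE adj_irrefl andbF. Qed.

Definition dunion : sgraph := SGraph dunion_adj_sym dunion_adj_irrefl.

Definition dunion_fun (f : forall i, G i -> nat) (x : dunion) : nat :=
  f (tag x) (tagged x).
End DisjointUnion.

Definition choosable (G : sgraph) (f : G -> nat) : Prop :=
  forall L : G -> {fset nat},
    (forall v, #|` L v| = f v) ->
    exists c : G -> nat,
      (forall v, c v \in L v) /\ (forall u v, adj u v -> c u != c v).

Definition independent (G : sgraph) (I : {set G}) : bool :=
  [forall u in I, forall v in I, ~~ adj u v].

(* Painter wins the painting game from the position in which [U] is the set of
   uncoloured vertices and each [v] in [U] holds [f v] tokens. Lister has won as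
   soon as some uncoloured vertex is out of tokens. Otherwise Lister marks a
   nonempty set [M] of uncoloured vertices, each of which loses one token, and
   Painter colours an independent subset [I] of [M]. When no vertex is left
   uncoloured both premises are vacuous, so Painter has won. *)
Inductive painter_wins (G : sgraph) (U : {set G}) (f : G -> nat) : Prop :=
  PainterWins of
    (forall v, v \in U -> 0 < f v) &
    (forall M : {set G}, M \subset U -> M != set0 ->
       exists I : {set G},
         [/\ I \subset M, independent I &
             painter_wins (U :\: I) (fun v => f v - (v \in M))]).

Definition paintable (G : sgraph) (f : G -> nat) : Prop :=
  painter_wins [set: G] f.

Definition extend (G : sgraph) (f : G -> nat) (m : nat)
    (x : join G (edgeless m)) : nat :=
  match x with inl v => f v | inr _ => #|G| end.

(* Extended natural numbers: [None] stands for infinity. *)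
Definition enat := option nat.

(* 0 times infinity is 0. *)
Definition emul (x y : enat) : enat :=
  match x, y with
  | Some a, Some b => Some (a * b)
  | Some 0, None | None, Some 0 => Some 0
  | _, _ => None
  end.

Lemma exists_asbool (P : nat -> Prop) :
  (exists m, P m) -> exists m, `[< P m >].
Proof. by case=> m Pm; exists m; apply/asboolP. Qed.

Definition emin (P : nat -> Prop) : enat :=
  match pselect (exists m, P m) with
  | left exP => Some (ex_minn (exists_asbool exP))
  | right _ => None
  end.

Definition m_c (G : sgraph) (f : G -> nat) : enat :=
  emin (fun m => ~ choosable (extend f (m := m))).

Definition m_p (G : sgraph) (f : G -> nat) : enat :=
  emin (fun m => ~ paintable (extend f (m := m))).

(* Main.v *)
(** Call a vertex of the edgeless part critical when it has exactly as many
tokens as there are uncoloured vertices of [G]. Painter can always save the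
non-critical ones, so the painting game on the join reduces to a game on [G]
with a counter [k] of critical vertices: Lister marks [M] and puts [b] of
[c + b] critical vertices at stake; [c] of them survive if Painter colours
nothing in [G], [b] survive if Painter colours one vertex of [G], and none if
Painter colours more. Let [mu] be the least [k] with which Lister wins. On a
disjoint union Lister can play in one component, which gives [mu <= \prod mu_i].
Conversely, if no [mu_i] is [0], then Painter has answers in every component
after which the corresponding value is nonzero; since colouring two vertices
makes the product zero, in all components but one the only such answer is the
empty set, and the product lower bound follows by induction.

For lists, [G] joined with [m] independent vertices fails to be choosable
exactly when [G] has lists all of whose proper colourings are injective and have
at most [m] colour sets altogether. For such lists on a disjoint union,
injectivity forces distinct components to use disjoint colours, so the numbers
of colour sets multiply. *)
Require Import Defs.
From HB Require Import structures.
From mathcomp Require Import all_boot finmap boolp zify.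

Set Implicit Arguments.
Unset Strict Implicit.
Unset Printing Implicit Defensive.

(** * Minima in the extended natural numbers and their products *)

Lemma emin_Some (P : nat -> Prop) (k : nat) :
  P k -> (forall m, P m -> k <= m) -> emin P = Some k.
Proof.
move=> Pk le_k; rewrite /emin; case: pselect => [exP | []]; last by exists k.
case: ex_minnP => m /asboolP Pm le_m; congr Some; apply/eqP.
by rewrite eqn_leq le_m ?le_k //; apply/asboolP.
Qed.

Lemma eq_emin (P Q : nat -> Prop) : (forall m, P m <-> Q m) -> emin P = emin Q.
Proof. by move=> PQ; congr emin; apply/funext => m; apply/propext. Qed.

(** Every [P i] is attained, so all minima are finite: the least witnesses give the upper bound,
    monotonicity of products the lower one. *)
Lemma emin_prod (p : nat) (P : 'I_p -> nat -> Prop) (Q : nat -> Prop) :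
  (forall i, exists m, P i m) ->
  (forall k : 'I_p -> nat, (forall i, P i (k i)) -> Q (\prod_i k i)) ->
  (forall m, Q m ->
     exists2 k : 'I_p -> nat, (forall i, P i (k i)) & \prod_i k i <= m) ->
  emin Q = \big[emul/Some 1]_(i < p) emin (P i).
Proof.
move=> exP PQ QP.
pose a i := ex_minn (exists_asbool (exP i)).
have aP i : P i (a i) /\ forall m, P i m -> a i <= m.
  rewrite /a; case: ex_minnP => m /asboolP Pm le_m.
  by split=> // n Pn; apply: le_m; apply/asboolP.
rewrite (eq_bigr (fun i => Some (a i))); last first.
  by move=> i _; case: (aP i); apply: emin_Some.
have -> : \big[emul/Some 1]_(i < p) Some (a i) = Some (\prod_i a i).
  by apply: (big_rec2 (fun (x : enat) n => x = Some n)) => // i y n _ ->; case: (a i).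
apply: emin_Some => [|m /QP[k Pk le_m]].
  by apply: PQ => i; case: (aP i).
apply: leq_trans le_m; apply: leq_prod => i _.
by case: (aP i) => _; apply.
Qed.

(** * The reduced painting game *)

Definition mark (G : sgraph) (f : G -> nat) (M : {set G}) (v : G) : nat :=
  f v - (v \in M).

(* Critical vertices left after Painter colours [n] vertices of [G]. *)
Definition budget (c b n : nat) : nat :=
  match n with 0 => c | 1 => b | _ => 0 end.

(** In [ListerEnd] nothing is left in [G], so a critical vertex has no token. In [ListerStep]
    Painter either colours the staked critical vertices or colours in [G], which is joined to all of
    them; one coloured vertex of [G] offsets the token lost by a staked vertex and makes the others
    non-critical. *)
Inductive lister_wins (G : sgraph) (U : {set G}) (f : G -> nat) : nat -> Prop :=
| ListerDead v k of v \in U & f v = 0 : lister_wins U f k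
| ListerEnd k of U = set0 & 0 < k : lister_wins U f k
| ListerStep (M : {set G}) c b of M \subset U & M != set0 &
    (forall I : {set G}, I \subset M -> independent I ->
       lister_wins (U :\: I) (mark f M) (budget c b #|I|)) :
    lister_wins U f (c + b).

Section ReducedGame.
Variable G : sgraph.
Implicit Types (U M I : {set G}) (f : G -> nat).

Lemma lister_wins_leq U f k l : k <= l -> lister_wins U f k -> lister_wins U f l.
Proof.
move=> le_kl w; elim: w l le_kl => {U f k}.
- by move=> U f v k vU fv l _; apply: ListerDead vU fv.
- by move=> U f k U0 k0 l le_kl; apply: ListerEnd => //; apply: leq_trans le_kl.
move=> U f M c b sMU M0 _ IH l le_l.
(* The surplus critical vertices are left unstaked. *)
have -> : l = (l - b) + b by lia.
apply: ListerStep sMU M0 _ => I sIM indI; apply: IH => //.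
by case: #|I| => //=; lia.
Qed.

Lemma independent0 : independent (set0 : {set G}).
Proof. by apply/forall_inP => v; rewrite inE. Qed.

(** Induction measure for both games: any move decreases it, since a marked vertex loses a token
    even if nothing gets coloured. *)
Definition weight U f : nat := #|U| + \sum_(v in U) f v.

Lemma weight_mark U f M I : M \subset U -> M != set0 ->
  (forall v, v \in U -> 0 < f v) ->
  weight (U :\: I) (mark f M) < weight U f.
Proof.
move=> sMU /set0Pn[v vM] f0; rewrite /weight -addnS leq_add ?subset_leq_card //.
  exact: subsetDl.
have vU := subsetP sMU v vM.
rewrite [X in _ < X](bigD1 v) //=.
apply: (@leq_ltn_trans (\sum_(w in U) mark f M w)).
  rewrite [X in _ <= X](bigID (mem (U :\: I))) /=.
  apply: leq_trans (leq_addr _ _).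
  by rewrite (eq_bigl (fun w => (w \in U) && (w \in U :\: I))) // => w;
    rewrite !inE; case: (w \in U); rewrite ?andbF.
rewrite (bigD1 v) //= -addSn leq_add //.
  by rewrite /mark vM; have := f0 v vU; lia.
by apply: leq_sum => w _; apply: leq_subr.
Qed.

(** If Lister marks a single vertex, Painter has only two answers; counters that win after each of
    them serve as [c] and [b]. *)
Lemma lister_wins_ex U f : exists k, lister_wins U f k.
Proof.
have [n] := ubnP (weight U f); elim: n U f => // n IH U f lt_n.
have [[v vU fv]|no_dead] := pselect (exists2 v, v \in U & f v = 0).
  by exists 0; apply: ListerDead vU fv.
have f0 v : v \in U -> 0 < f v.
  by move=> vU; rewrite lt0n; apply/eqP => fv; apply: no_dead; exists v.
have [U0|[v vU]] := set_0Vmem U; first by exists 1; apply: ListerEnd.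
have sU : [set v] \subset U by rewrite sub1set.
have v0 : [set v] != set0 by rewrite -card_gt0 cards1.
have lt I := leq_trans (weight_mark I sU v0 f0) lt_n.
have [c wc] := IH _ _ (lt set0); have [b wb] := IH _ _ (lt [set v]).
exists (c + b); apply: (ListerStep sU v0) => I.
by rewrite subset1 => /orP[] /eqP -> _; rewrite ?cards1 ?cards0.
Qed.

Definition mu U f : nat :=
  ex_minn (exists_asbool (lister_wins_ex U f)).

Lemma lister_wins_mu U f : lister_wins U f (mu U f).
Proof. by rewrite /mu; case: ex_minnP => k /asboolP. Qed.

Lemma leq_mu U f k : lister_wins U f k -> mu U f <= k.
Proof. by rewrite /mu; case: ex_minnP => l _ + w; apply; apply/asboolP. Qed.

Lemma mu_leqP U f k : mu U f <= k <-> lister_wins U f k.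
Proof.
by split=> [le_k|]; [apply: lister_wins_leq le_k (lister_wins_mu U f)|apply: leq_mu].
Qed.

Lemma mu_dead U f v : v \in U -> f v = 0 -> mu U f = 0.
Proof.
by move=> vU fv; apply/eqP; rewrite -leqn0; apply: leq_mu; apply: ListerDead vU fv.
Qed.

Lemma mu_step U f M c b : M \subset U -> M != set0 ->
  (forall I, I \subset M -> independent I ->
     mu (U :\: I) (mark f M) <= budget c b #|I|) ->
  mu U f <= c + b.
Proof.
move=> sMU M0 H; apply: leq_mu; apply: ListerStep sMU M0 _ => I sIM indI.
by apply/mu_leqP; apply: H.
Qed.

End ReducedGame.

Lemma mu_set0 (G : sgraph) (f : G -> nat) : mu set0 f = 1.
Proof.
apply/eqP; rewrite eqn_leq leq_mu /=; last exact: ListerEnd.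
have := lister_wins_mu set0 f; move: (mu _ _) => k; case=> //.
- by move=> v k' /=; rewrite inE.
- by move=> M c b; rewrite subset0 => ->.
Qed.

(** * The reduced game on a disjoint union *)

Lemma mark0 (G : sgraph) (f : G -> nat) : mark f set0 = f.
Proof. by apply/funext => v; rewrite /mark inE subn0. Qed.

(** A win with counter exactly [mu U f] must begin with a move, since neither terminal case
    applies. *)
Lemma mu_stepE (G : sgraph) (U : {set G}) (f : G -> nat) :
  U != set0 -> (forall v, v \in U -> 0 < f v) ->
  exists (M : {set G}) c b, [/\ M \subset U, M != set0, mu U f = c + b &
    forall I : {set G}, I \subset M -> independent I ->
      mu (U :\: I) (mark f M) <= budget c b #|I|].
Proof.
move=> U0 f0; case: (lister_wins_mu U f) => [v k vU fv|k /eqP|M c b sMU M0 w].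
- by have := f0 v vU; rewrite fv.
- by rewrite (negPf U0).
exists M, c, b; split=> // I sIM indI; exact/mu_leqP/w.
Qed.

Section Slices.
Variables (p : nat) (G : 'I_p -> sgraph).
Implicit Types (U M : {set dunion G}) (f : dunion G -> nat).
Implicit Types (S : forall i, {set G i}).

Definition inc (i : 'I_p) (v : G i) : dunion G := existT _ i v.

Definition slice U (i : 'I_p) : {set G i} := [set v | inc v \in U].

Definition glue S : {set dunion G} :=
  [set x : dunion G | tagged x \in S (tag x)].

Definition glue1 (i : 'I_p) (I : {set G i}) : {set dunion G} :=
  glue (dfwith (fun j => set0 : {set G j}) I).

Lemma slice_glue S i : slice (glue S) i = S i.
Proof. by apply/setP => v; rewrite !inE. Qed.

Lemma sliceD U M i : slice (U :\: M) i = slice U i :\: slice M i.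
Proof. by apply/setP => v; rewrite !inE. Qed.

Lemma slice0 i : slice set0 i = set0.
Proof. by apply/setP => v; rewrite !inE. Qed.

Lemma slice_mark f M i : mark f M \o @inc i = mark (f \o @inc i) (slice M i).
Proof. by apply/funext => v; rewrite /= /mark inE. Qed.

Lemma slice_sub U M i : U \subset M -> slice U i \subset slice M i.
Proof. by move=> /subsetP sUM; apply/subsetP => v; rewrite !inE; apply: sUM. Qed.

Lemma eq_slice U M : (forall i, slice U i = slice M i) -> U = M.
Proof. by move=> e; apply/setP => -[i v]; have /setP/(_ v) := e i; rewrite !inE. Qed.

Lemma glue_sub S M : (forall i, S i \subset slice M i) -> glue S \subset M.
Proof.
move=> sS; apply/subsetP => -[i v]; rewrite inE => /(subsetP (sS i)).
by rewrite inE.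
Qed.

Lemma slice_glue1_in (i : 'I_p) (I : {set G i}) : slice (glue1 I) i = I.
Proof. by rewrite slice_glue dfwith_in. Qed.

Lemma slice_glue1_out (i j : 'I_p) (I : {set G i}) :
  i != j -> slice (glue1 I) j = set0.
Proof. by move=> ij; rewrite slice_glue dfwith_out. Qed.

Lemma card_glue1 (i : 'I_p) (I : {set G i}) : #|glue1 I| = #|I|.
Proof.
have inc_inj : injective (@inc i) by move=> u v /eqP; rewrite eq_Tagged => /eqP.
rewrite -(card_imset (mem I) inc_inj); apply: eq_card => x.
apply/idP/imsetP => [|[v vI ->]]; last first.
  by rewrite inE /= dfwith_in.
case: x => j v; rewrite inE /=; case: dfwithP v => [v vI|k _ v].
  by exists v.
by rewrite inE.
Qed.

Lemma sub_glue1 (i : 'I_p) (M : {set G i}) U : U \subset glue1 M ->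
  U = glue1 (slice U i).
Proof.
move=> sUM; apply: eq_slice => j; have [<-|ij] := eqVneq i j.
  by rewrite slice_glue1_in.
rewrite slice_glue1_out //; apply/eqP; rewrite -subset0.
by rewrite -(slice_glue1_out M ij) slice_sub.
Qed.

Lemma adj_inc i (u v : G i) : adj (inc u) (inc v) = adj u v.
Proof. by rewrite /= /dunion_adj /= eqxx tagged_asE. Qed.

Lemma independent_slice U i : independent U -> independent (slice U i).
Proof.
move=> /forall_inP indU; apply/forall_inP => u; rewrite inE => uU.
apply/forall_inP => v; rewrite inE => vU; rewrite -adj_inc.
by have /forall_inP := indU _ uU; apply.
Qed.

Lemma independent_glue S : (forall i, independent (S i)) -> independent (glue S).
Proof.
move=> indS; apply/forall_inP => -[i u]; rewrite inE /= => uS.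
apply/forall_inP => -[j v]; rewrite inE /= => vS.
rewrite /dunion_adj /=; case: (eqVneq i j) => //= eij; subst j.
rewrite tagged_asE.
by have /forall_inP /(_ u uS) /forall_inP := indS i; apply.
Qed.

(** Lister plays an optimal move in a nonempty component; the others are untouched, so the product
    [P] of their values scales both parts of the counter. *)
Lemma lister_wins_dunion U f :
  lister_wins U f (\prod_i mu (slice U i) (f \o @inc i)).
Proof.
have [n] := ubnP (weight U f); elim: n U f => // n IH U f lt_n.
have [[x xU fx]|no_dead] := pselect (exists2 x, x \in U & f x = 0).
  exact: ListerDead xU fx.
have f0 x : x \in U -> 0 < f x.
  by move=> xU; rewrite lt0n; apply/eqP => fx; apply: no_dead; exists x.
have [->|[[i v] xU]] := set_0Vmem U.
  by apply: ListerEnd; rewrite // big1 // => i _; rewrite slice0 mu_set0.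
have Ui0 : slice U i != set0 by apply/set0Pn; exists v; rewrite inE.
have [|M [c [b [sMU M0 eq_mu stepM]]]] := mu_stepE (f := f \o @inc i) Ui0.
  by move=> w; rewrite inE => /f0.
set P := \prod_(j | j != i) mu (slice U j) (f \o @inc j).
rewrite (bigD1 i) //= -/P eq_mu mulnDl.
have sM : glue1 M \subset U.
  apply: glue_sub => j; case: dfwithP => // k _; exact: sub0set.
have gM0 : glue1 M != set0 by rewrite -card_gt0 card_glue1 card_gt0.
apply: (ListerStep sM gM0) => I sIM indI.
apply: lister_wins_leq (IH _ _ (leq_trans (weight_mark _ sM gM0 f0) lt_n)).
have sI : slice I i \subset M by rewrite -(slice_glue1_in M) slice_sub.
rewrite (sub_glue1 sIM) card_glue1 (bigD1 i) //=.
rewrite [X in _ * X](_ : _ = P); last first.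
  apply: eq_bigr => j; rewrite eq_sym => ij.
  by rewrite sliceD slice_mark !(slice_glue1_out _ ij) setD0 mark0.
rewrite sliceD slice_mark !slice_glue1_in.
have : mu (slice U i :\: slice I i) (mark (f \o @inc i) M) * P <=
       budget c b #|slice I i| * P.
  by rewrite leq_mul2r stepM ?orbT // independent_slice.
by case: #|slice I i| => [|[|]].
Qed.

Lemma card_glue_gt1 S (i j : 'I_p) :
  i != j -> S i != set0 -> S j != set0 -> 1 < #|glue S|.
Proof.
move=> ij /set0Pn[u uS] /set0Pn[v vS].
apply: (@leq_trans #|[set inc u; inc v]|).
  rewrite cards2; case: eqP => // e.
  by move: ij; rewrite -(congr1 tag e : i = j) eqxx.
apply/subset_leq_card/subsetP => x /set2P[] ->; by rewrite inE.
Qed.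

(** If no component has value 0, the nonempty answers that keep a value nonzero occur in a single
    component [i0]; there the budgets of Lister, divided by the product [P] of the other values,
    bound the value. *)
Lemma lister_wins_dunion_leq U f k : lister_wins U f k ->
  \prod_i mu (slice U i) (f \o @inc i) <= k.
Proof.
elim=> {U f k}.
- move=> U f [i v] k vU fv; rewrite (bigD1 i) //= (@mu_dead _ _ _ v) //.
  by rewrite inE.
- by move=> U f k -> k0; rewrite big1 // => i _; rewrite slice0 mu_set0.
move=> U f M c b sMU M0 _ IH.
have [/existsP[i /eqP mu0]|] :=
    boolP [exists i, mu (slice U i) (f \o @inc i) == 0].
  by rewrite (bigD1 i) //= mu0.
rewrite negb_exists => /forallP mu_gt0.
pose nu i (I : {set G i}) := mu (slice U i :\: I) (mark (f \o @inc i) (slice M i)).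
have step S : (forall i, S i \subset slice M i) ->
    (forall i, independent (S i)) -> \prod_i nu i (S i) <= budget c b #|glue S|.
  move=> sS indS; have := IH _ (glue_sub sS) (independent_glue indS).
  congr (_ <= _); apply: eq_bigr => i _.
  by rewrite sliceD slice_glue slice_mark.
pose win i (I : {set G i}) := [&& I \subset slice M i, independent I & 0 < nu i I].
have sM i : slice M i \subset slice U i by apply: slice_sub.
have ex_win i : exists J, win i J.
  apply/existsP; apply: contraT; rewrite negb_exists => /forallP lose.
  have [Mi0|Mi0] := eqVneq (slice M i) set0.
    have := lose set0; rewrite /win sub0set independent0 /nu Mi0 mark0 setD0 /=.
    by rewrite lt0n mu_gt0.
  (* If every answer led to value 0, this move with [c = b = 0] would give value 0 already before
     it. *)
  have := mu_gt0 i; rewrite -leqn0 (@mu_step _ _ _ (slice M i) 0 0) // => I sI indI.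
  by have := lose I; rewrite /win sI indI /= -leqNgt => /leq_trans; apply.
pose J i := xchoose (ex_win i).
have winJ i : win i (J i) by apply: xchooseP.
(* Two components with nonempty winning answers would give a nonzero product
   after Painter colours at least two vertices. *)
have [i0 lose] : exists i0, forall i I, i0 != i -> win i I -> I = set0.
  have [[i0 [I [winI I0]]]|none] :=
      pselect (exists i I, win i I /\ I != set0); last first.
    (* No component has a nonempty winning answer, so any of them can serve as [i0]. *)
    have /set0Pn[[i0 _] _] := M0; exists i0 => i I _ winI.
    by apply/eqP; apply: contraT => I0; case: none; exists i, I.
  exists i0 => i I' ii0 winI'; apply/eqP; apply: contraT => I'0.
  pose S := dfwith (dfwith J I) I'.
  have winS j : win j (S j).
    by rewrite /S; case: dfwithP => // k _; case: dfwithP.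
  have : 0 < budget c b #|glue S|.
    apply: leq_trans (step S _ _).
    - by rewrite prodn_gt0 // => j; case/and3P: (winS j).
    - by move=> j; case/and3P: (winS j).
    - by move=> j; case/and3P: (winS j).
  have := @card_glue_gt1 S i0 i.
  have i0i : i != i0 by rewrite eq_sym.
  rewrite /S dfwith_in dfwith_out // dfwith_in => /(_ ii0 I0 I'0).
  by case: #|_| => [|[|]].
pose P := \prod_(i | i != i0) nu i set0.
have P_gt0 : 0 < P.
  apply: prodn_cond_gt0 => i; rewrite eq_sym => ii0.
  by have /and3P[_ _] := winJ i; rewrite (lose i _ ii0 (winJ i)).
have le_nu i : i0 != i -> mu (slice U i) (f \o @inc i) <= nu i set0.
  move=> ii0; have [Mi0|Mi0] := eqVneq (slice M i) set0.
    by rewrite /nu Mi0 setD0 mark0.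
  (* Lister needs nothing at stake here ([b = 0]), because every nonempty answer leaves value 0. *)
  rewrite -[nu i set0]addn0; apply: mu_step (sM i) Mi0 _ => I sI indI.
  have [->|I0] := eqVneq I set0; first by rewrite cards0.
  suff : nu i I = 0 by rewrite /nu => ->.
  apply/eqP; apply: contraT; rewrite -lt0n => nu_gt0.
  by move/eqP: I0; case; apply: (lose i) => //; apply/and3P.
(* Painter answers only in [i0]; the other components contribute the factor [P], and dividing by it
   leaves a budget for [i0] alone. *)
have step1 (I : {set G i0}) : I \subset slice M i0 -> independent I ->
    nu i0 I <= budget (c %/ P) (b %/ P) #|I|.
  move=> sI indI.
  have : nu i0 I * P <= budget c b #|I|.
    have := step (dfwith (fun j => set0 : {set G j}) I).
    rewrite (bigD1 i0) //= dfwith_in -/(glue1 I) card_glue1.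
    rewrite [X in _ * X](_ : _ = P); last first.
      by apply: eq_bigr => j ji0; rewrite dfwith_out // eq_sym.
    apply=> j; case: dfwithP => // k _; rewrite ?sub0set //; exact: independent0.
  by rewrite -leq_divRL //; case: #|I| => [|[|]] //=; rewrite div0n.
have le_mu0 : mu (slice U i0) (f \o @inc i0) <= c %/ P + b %/ P.
  have [Mi0|Mi0] := eqVneq (slice M i0) set0; last first.
    exact: mu_step (sM i0) Mi0 step1.
  (* Here [M] misses [i0], so the empty answer leaves this component unchanged and [c %/ P] alone
     bounds its value. *)
  have := step1 set0 (sub0set _) (independent0 _).
  rewrite /nu Mi0 setD0 mark0 cards0 /= => le_c.
  exact: leq_trans le_c (leq_addr _ _).
rewrite (bigD1 i0) //=; apply: (@leq_trans ((c %/ P + b %/ P) * P)).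
  apply: leq_mul => //; apply: leq_prod => i; rewrite eq_sym; exact: le_nu.
by rewrite mulnDl leq_add // leq_trunc_div.
Qed.

End Slices.

(** * From the painting game on the join to the reduced game *)

Section JoinGame.
Variables (G : sgraph) (m : nat).
Let J : sgraph := join G (edgeless m).
Implicit Types (U M I : {set J}) (f : J -> nat).
Implicit Types (A : {set G}) (B : {set 'I_m}).

Definition left_part U : {set G} := [set v | (inl v : J) \in U].

Definition right_part U : {set 'I_m} := [set j | (inr j : J) \in U].

Definition join_set A B : {set J} :=
  [set x : J | match x with inl v => v \in A | inr j => j \in B end].

(** The test is an inequality; under the token invariant of [painter_wins_join] it amounts to
    equality. *)
Definition critical U f : {set 'I_m} :=
  [set j in right_part U | f (inr j) <= #|left_part U|].

Lemma left_join_set A B : left_part (join_set A B) = A.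
Proof. by apply/setP => v; rewrite !inE. Qed.

Lemma left_partD U I : left_part (U :\: I) = left_part U :\: left_part I.
Proof. by apply/setP => v; rewrite !inE. Qed.

Lemma left_part_sub U M : U \subset M -> left_part U \subset left_part M.
Proof. by move=> /subsetP sUM; apply/subsetP => v; rewrite !inE; apply: sUM. Qed.

Lemma join_set_sub A B M :
  A \subset left_part M -> B \subset right_part M -> join_set A B \subset M.
Proof.
move=> /subsetP sA /subsetP sB; apply/subsetP => -[v|j]; rewrite inE.
  by move=> /sA; rewrite inE.
by move=> /sB; rewrite inE.
Qed.

Lemma left_mark f M : mark f M \o inl = mark (f \o inl) (left_part M).
Proof. by apply/funext => v; rewrite /= /mark inE. Qed.

Lemma independent_left I : independent I -> independent (left_part I).
Proof.
move=> /forall_inP indI; apply/forall_inP => u; rewrite inE => uI.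
apply/forall_inP => v; rewrite inE => vI.
by have /forall_inP /(_ _ vI) := indI _ uI.
Qed.

Lemma independent_right I u :
  independent I -> u \in left_part I -> right_part I = set0.
Proof.
move=> /forall_inP indI; rewrite inE => /indI /forall_inP adjI.
apply/setP => j; rewrite !inE; apply/negP => /adjI.
by [].
Qed.

Lemma independent_join_set A B :
  independent A -> (A == set0) || (B == set0) -> independent (join_set A B).
Proof.
move=> /forall_inP indA AB; apply/forall_inP => x xI; apply/forall_inP => y yI.
case/orP: AB xI yI => /eqP -> ; case: x => [u|i]; case: y => [v|j]; rewrite !inE //.
by move=> uA vA; have /forall_inP := indA _ uA; apply.
Qed.

(** Lister copies the reduced strategy, marking [M] together with [b] critical vertices. *)
Lemma lister_wins_not_painter (U0 : {set G}) (f0 : G -> nat) (k : nat) :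
  lister_wins U0 f0 k -> forall U f, left_part U = U0 -> f \o inl = f0 ->
  k <= #|critical U f| -> ~ painter_wins U f.
Proof.
elim=> {U0 f0 k}.
- move=> U0 f0 v k vU fv U f eU ef _ [/(_ (inl v)) f_gt0 _].
  by move: vU f_gt0 fv; rewrite -eU -ef inE /= => vU /(_ vU); case: (f _).
- move=> U0 f0 k U0_0 k0 U f eU ef le_k [f_gt0 _].
  have /card_gt0P[j] := leq_trans k0 le_k.
  rewrite !inE eU U0_0 cards0 => /andP[/f_gt0].
  by rewrite leqn0; case: (f _).
move=> U0 f0 M c b sMU M0 _ IH U f eU ef le_k [_ play].
have /card_geqP[s [uniq_s size_s sub_s]] : b <= #|critical U f| by lia.
pose B := [set j in s].
have cardB : #|B| = b by rewrite cardsE -size_s; apply/card_uniqP.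
have sBC : B \subset critical U f by apply/subsetP => j; rewrite inE => /sub_s.
have sMB : join_set M B \subset U.
  apply: join_set_sub; first by rewrite eU.
  by apply: subset_trans sBC _; apply/subsetP => j; rewrite inE => /andP[].
have MB0 : join_set M B != set0.
  by have /set0Pn[v vM] := M0; apply/set0Pn; exists (inl v); rewrite inE.
have [I [sI indI]] := play _ sMB MB0.
have sIM : left_part I \subset M by rewrite -(left_join_set M B) left_part_sub.
apply: IH (sIM) (independent_left indI) _ _ _ _ _.
- by rewrite left_partD eU.
- by rewrite -/(mark f (join_set M B)) left_mark left_join_set ef.
rewrite /critical left_partD eU.
have [I0|[u uI]] := set_0Vmem (left_part I).
  (* Painter coloured nothing in [G]: the critical vertices outside [B] are unmarked, so they keep
     their tokens and stay uncoloured. *)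
  rewrite I0 setD0 cards0 /=; apply: (@leq_trans #|critical U f :\: B|).
    by rewrite cardsD (setIidPr sBC) cardB; lia.
  apply/subset_leq_card/subsetP => j; rewrite in_setD !inE eU => /andP[jB /andP[jU fj]].
  rewrite jU andbT; apply/andP; split; last by apply: leq_trans fj; apply: leq_subr.
  by apply: contra jB => /(subsetP sI); rewrite !inE.
(* A coloured vertex of [G] is adjacent to the whole edgeless part, so nothing there is coloured in
   this round. *)
have := independent_right indI uI => /setP right0.
have cardD : #|U0 :\: left_part I| = #|U0| - #|left_part I|.
  by rewrite cardsD (setIidPr (subset_trans sIM sMU)).
have : 0 < #|left_part I| by apply/card_gt0P; exists u.
(* Only one coloured vertex needs an argument: each vertex of [B] loses one token while one vertex
   of [G] is coloured, so it stays critical. *)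
case eI: #|left_part I| => [|[|l]] //= _.
rewrite -cardB; apply/subset_leq_card/subsetP => j jB.
have /andP[jU fj] : ((inr j : J) \in U) && (f (inr j) <= #|U0|).
  by have := subsetP sBC j jB; rewrite !inE eU.
have jI : (inr j : J) \notin I by have := right0 j; rewrite !inE => ->.
have jM : (inr j : J) \in join_set M B by rewrite inE.
rewrite inE; apply/andP; split; first by rewrite inE in_setD jI.
by rewrite jM cardD eI leq_sub2r.
Qed.

(** Painter follows the reduced game, keeping at least as many tokens on each uncoloured vertex of
    the edgeless part as there are uncoloured vertices of [G]. *)
Lemma painter_wins_join U f :
  (forall j, j \in right_part U -> #|left_part U| <= f (inr j)) ->
  ~ lister_wins (left_part U) (f \o inl) #|critical U f| ->
  painter_wins U f.
Proof.
have [n] := ubnP (weight U f); elim: n U f => // n IH U f lt_n tok win.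
have f_gt0 x : x \in U -> 0 < f x.
  case: x => [v|j] xU; rewrite lt0n; apply/eqP => fx; apply: win.
    by apply: (@ListerDead _ _ _ v); rewrite ?inE.
  have := tok j; rewrite inE fx leqn0 cards_eq0 => /(_ xU) /eqP U0.
  by apply: ListerEnd => //; apply/card_gt0P; exists j; rewrite !inE fx xU.
split=> // M sMU M0.
have next I := IH _ _ (leq_trans (weight_mark I sMU M0 f_gt0) lt_n).
have [LM0|LM0] := eqVneq (left_part M) set0.
  (* No vertex of [G] is marked, so [M] is independent and Painter colours all of it. *)
  exists M; split=> //.
    apply/forall_inP => x xM; apply/forall_inP => y yM.
    have no_left v : (inl v : J) \notin M.
      by have /setP/(_ v) := LM0; rewrite !inE => ->.
    by case: x xM => [u|i]; case: y yM => [v|j] //; rewrite (negPf (no_left _)).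
  apply: (next M).
    move=> j; rewrite left_partD LM0 setD0 /mark !inE => /andP[/negPf -> jU].
    by rewrite subn0 tok // inE.
  rewrite left_partD left_mark LM0 setD0 mark0 => w; apply: win.
  apply: lister_wins_leq w; apply/subset_leq_card/subsetP => j.
  rewrite !inE left_partD LM0 setD0 /mark => /andP[/andP[/negPf -> ->]].
  by rewrite subn0.
pose B := right_part M; pose C := critical U f.
have [I0 [sI0 indI0 winI0]] : exists I0 : {set G},
    [/\ I0 \subset left_part M, independent I0 &
       ~ lister_wins (left_part U :\: I0) (mark (f \o inl) (left_part M))
           (budget #|C :\: B| #|C :&: B| #|I0|)].
  (* Otherwise Lister would win the reduced game by marking [left_part M] and staking the marked
     critical vertices. *)
  apply: contrapT => none; apply: win; rewrite -(cardsID B) addnC.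
  apply: ListerStep (left_part_sub sMU) LM0 _ => I sI indI.
  by apply: contrapT => nw; apply: none; exists I.
(* Marked vertices of the edgeless part can be coloured only when nothing in [G] is. *)
pose I := join_set I0 (if I0 == set0 then B else set0).
have sIM : I \subset M.
  by apply: join_set_sub => //; case: ifP => // _; apply: sub0set.
have rI j : ((inr j : J) \in I) = (I0 == set0) && ((inr j : J) \in M).
  by rewrite inE; case: ifP; rewrite inE.
have cardD : #|left_part U :\: I0| = #|left_part U| - #|I0|.
  by rewrite cardsD (setIidPr (subset_trans sI0 (left_part_sub sMU))).
have leI0 : #|I0| <= #|left_part U|.
  by apply/subset_leq_card/(subset_trans sI0)/left_part_sub.
have indI : independent I.
  by apply: independent_join_set => //; case: ifP => //= _; apply: eqxx.
have lI : left_part I = I0 by apply: left_join_set.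
clearbody I; exists I; split=> //.
have I00 : (#|I0| == 0) = (I0 == set0) by rewrite cards_eq0.
apply: (next I).
  (* If [I0] is empty, all marked vertices of the edgeless part get coloured; otherwise the drop in
     uncoloured vertices of [G] pays for the lost token. *)
  move=> j; rewrite left_partD lI cardD !inE rI /mark -I00 => /andP[jI jU].
  have := tok j; rewrite inE => /(_ jU).
  by case: (_ \in M) jI; case: #|I0| => [|l] //=; lia.
rewrite left_partD lI left_mark => w; apply: winI0.
apply: lister_wins_leq w.
(* A vertex loses at most one token: after one coloured vertex of [G] only a marked critical vertex
   can still be critical, after two or more none can. *)
suff sub : critical (U :\: I) (mark f M) \subset
    (match #|I0| with 0 => C :\: B | 1 => C :&: B | _ => set0 end).
  have := subset_leq_card sub.
  by case: #|I0| => [|[|l]] //=; rewrite cards0.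
apply/subsetP => j.
rewrite /critical left_partD lI cardD !inE rI /mark -I00.
move=> /andP[/andP[jI jU]].
have := tok j; rewrite inE => /(_ jU).
have : (inr j : J) \in M -> 0 < f (inr j) by move=> _; apply: f_gt0.
by move: leI0 jI; case: #|I0| => [|[|l]]; rewrite /C /B !inE ?jU /=;
  case: (_ \in M) => //=; lia.
Qed.

End JoinGame.

(** Every vertex of the edgeless part starts with [#|G|] tokens, so all [m] of them are critical at
    the start. *)
Lemma not_paintable_extend (G : sgraph) (f : G -> nat) (m : nat) :
  ~ paintable (extend f (m := m)) <-> lister_wins [set: G] f m.
Proof.
have leftT : left_part [set: join G (edgeless m)] = [set: G].
  by apply/setP => v; rewrite !inE.
have crT : critical [set: join G (edgeless m)] (extend f (m:=m)) = setT.
  by apply/setP => j; rewrite !inE leftT cardsT leqnn.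
split=> [np|w].
  apply: contrapT => nw; apply: np; apply: painter_wins_join.
    by move=> j _; rewrite leftT cardsT leqnn.
  by rewrite crT leftT cardsT card_ord.
apply: (lister_wins_not_painter w) => //.
by rewrite crT cardsT card_ord.
Qed.

Lemma m_p_dunion (p : nat) (G : 'I_p -> sgraph) (f : forall i, G i -> nat) :
  m_p (G := dunion G) (dunion_fun f) =
    \big[emul/Some 1]_(i < p) m_p (G := G i) (f i).
Proof.
have sliceT i : slice [set: dunion G] i = setT by apply/setP => v; rewrite !inE.
rewrite /m_p; under [RHS]eq_bigr => i _ do
  rewrite (eq_emin (@not_paintable_extend _ (f i))).
rewrite (eq_emin (@not_paintable_extend _ (dunion_fun f))).
apply: emin_prod => [i|k w|m w].
- exact: lister_wins_ex.
- apply: lister_wins_leq (lister_wins_dunion _ _).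
  by apply: leq_prod => i _; rewrite sliceT; apply/mu_leqP/w.
exists (fun i => mu [set: G i] (f i)); first by move=> i; apply: lister_wins_mu.
apply: leq_trans (lister_wins_dunion_leq w).
by apply: leq_prod => i _; rewrite sliceT.
Qed.

(** * List colourings *)

Section ListColoring.
Variables (G : sgraph) (C : finType) (L : G -> {set C}).

Definition list_coloring (c : G -> C) : bool :=
  [forall v, c v \in L v] && [forall u, forall v, adj u v ==> (c u != c v)].

Lemma list_coloringP (c : G -> C) :
  reflect ((forall v, c v \in L v) /\ (forall u v, adj u v -> c u != c v))
    (list_coloring c).
Proof.
apply: (iffP andP) => -[cL adjc]; split.
- by move=> v; apply: (forallP cL).
- by move=> u v; have /forallP/(_ v)/implyP := forallP adjc u.
- by apply/forallP.
- by apply/forallP => u; apply/forallP => v; apply/implyP; apply: adjc.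
Qed.

Definition images : {set {set C}} :=
  [set [set c v | v : G] | c : {ffun G -> C} & list_coloring c].

Lemma imagesP (S : {set C}) :
  reflect (exists2 c : G -> C, list_coloring c & S = [set c v | v : G])
    (S \in images).
Proof.
apply: (iffP imsetP) => [[c cP ->]|[c cP ->]].
  by exists c => //; rewrite inE in cP.
have fc : (finfun c : G -> C) = c by apply/funext => v; rewrite ffunE.
by exists (finfun c); rewrite ?inE fc.
Qed.

End ListColoring.

(** Colours come from an arbitrary finite type, which allows colours tagged by their component. The
    bound counts colour sets, not colourings. *)
Definition rainbow_lists (G : sgraph) (f : G -> nat) (m : nat) : Prop :=
  exists (C : finType) (L : G -> {set C}),
    [/\ forall v, #|L v| = f v,
        forall c, list_coloring L c -> injective c &
        #|images L| <= m].

(** A colouring of [G] fails to extend only if its colour set contains the list of some vertex [j];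
    that list has [#|G|] elements, so the two are equal and the colouring is injective. *)
Lemma not_choosable_rainbow (G : sgraph) (f : G -> nat) (m : nat) :
  ~ choosable (extend f (m := m)) -> rainbow_lists f m.
Proof.
move=> nch.
have [L [cardL noL]] : exists L : join G (edgeless m) -> {fset nat},
    (forall x, #|` L x| = extend f x) /\
    ~ exists c : join G (edgeless m) -> nat,
      (forall v, c v \in L v) /\ (forall u v, adj u v -> c u != c v).
  apply: contrapT => no; apply: nch => L cardL; apply: contrapT => noL.
  by apply: no; exists L.
pose D := (\bigcup_(v <- enum G) L (inl v))%fset.
have LD v : (L (inl v) `<=` D)%fset.
  by apply/fsubsetP => x xL; apply/bigfcupP; exists v; rewrite ?mem_enum.
pose L' v : {set D} := fsub D (L (inl v)).
pose T j : {set D} := fsub D (L (inr j)).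
have key c : list_coloring L' c ->
    injective c /\ exists j, [set c v | v : G] = T j.
  move=> /list_coloringP[cL' adjc].
  have [j Lj] : exists j, forall x, x \in L (inr j) -> exists v, x = val (c v).
    apply: contrapT => none; apply: noL.
    have exd j : {d | d \in L (inr j) & forall v, d != val (c v)}.
      apply: cid2; apply: contrapT => no; apply: none; exists j => x xL.
      apply: contrapT => nv; apply: no; exists x => // v.
      by apply/eqP => xv; apply: nv; exists v.
    exists (fun x => match x with inl v => val (c v) | inr j => s2val (exd j) end).
    split=> [[v|j]|[u|i] [v|j]] //=.
    - by have := cL' v; rewrite inE.
    - exact: s2valP (exd j).
    - exact: adjc.
    - by rewrite eq_sym (s2valP' (exd j)).
    - by rewrite (s2valP' (exd i)).
  have LjD : (L (inr j) `<=` D)%fset.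
    by apply/fsubsetP => x /Lj[v ->]; apply: valP.
  have sT : T j \subset [set c v | v : G].
    apply/subsetP => x; rewrite inE => /Lj[v /val_inj ->].
    exact: imset_f.
  have cardT : #|T j| = #|G| by rewrite card_fsub.
  have eT : T j = [set c v | v : G].
    by apply/eqP; rewrite eqEcard sT cardT leq_imset_card.
  split; last by exists j.
  have /imset_injP injc : #|[set c v | v : G]| == #|G|.
    by rewrite -eT cardT.
  by move=> u v; apply: injc.
exists D, L'; split=> [v|c /key[]//|].
  by rewrite card_fsub // cardL.
apply: (@leq_trans #|[set T j | j : 'I_m]|).
  apply/subset_leq_card/subsetP => S /imagesP[c /key[_ [j ->]] ->].
  exact: imset_f.
by apply: leq_trans (leq_imset_card _ _) _; rewrite card_ord.
Qed.

(** The colour sets serve as lists of the edgeless part: each has [#|G|] colours by injectivity, and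
    each colouring of [G] is blocked by its own colour set. *)
Lemma rainbow_not_choosable (G : sgraph) (f : G -> nat) (m : nat) :
  rainbow_lists f m -> ~ choosable (extend f (m := m)).
Proof.
move=> [C [L [cardL rainbow le_m]]] ch.
pose code (a : C) : nat := val (enum_rank a).
have code_inj : injective code by move=> a b /val_inj /enum_rank_inj.
pose F (A : {set C}) : {fset nat} := [fset code a | a in A]%fset.
have cardF A : #|` F A| = #|A| by rewrite card_imfset //= -cardE.
pose L' (x : join G (edgeless m)) : {fset nat} :=
  match x with
  | inl v => F (L v)
  | inr j => if j < #|images L| then F (nth set0 (enum (images L)) j)
             (* Surplus vertices get an arbitrary list of the right size. *)
             else [fset i in iota 0 #|G|]%fset
  end.
have [x|c [cL' adjc]] := ch L'.
  case: x => [v|j] /=; first by rewrite cardF cardL.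
  case: ifP => [lt_j|_].
    rewrite cardF.
    have : nth set0 (enum (images L)) j \in images L.
      by rewrite -mem_enum mem_nth // -cardE.
    by case/imagesP => c /rainbow c_inj ->; rewrite card_imset // cardsT.
  by rewrite card_imfset //= undup_id ?iota_uniq ?size_iota.
have exd v : {a | a \in L v & c (inl v) = code a}.
  by apply: cid2; have /imfsetP[a] := cL' (inl v); exists a.
pose d v := s2val (exd v).
have dL v : d v \in L v := s2valP (exd v).
have cd v : c (inl v) = code (d v) := s2valP' (exd v).
have dP : list_coloring L d.
  apply/list_coloringP; split=> // u v uv.
  by have := adjc (inl u) (inl v) uv; rewrite !cd; apply: contraNneq => ->.
have SL : [set d v | v : G] \in images L by apply/imagesP; exists d.
have lt_j : index [set d v | v : G] (enum (images L)) < #|images L|.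
  by rewrite cardE index_mem mem_enum.
pose j := Ordinal (leq_trans lt_j le_m).
have := cL' (inr j); rewrite /= lt_j nth_index ?mem_enum //.
case/imfsetP => a /imsetP[v _ ->] cj.
by have := adjc (inl v) (inr j) isT; rewrite cd cj eqxx.
Qed.

(** With pairwise disjoint lists every choice of colours is injective. *)
Lemma rainbow_lists_ex (G : sgraph) (f : G -> nat) : exists m, rainbow_lists f m.
Proof.
pose C : finType := {v : G & 'I_(f v)}.
pose L (v : G) : {set C} := [set Tagged (fun v => 'I_(f v)) a | a : 'I_(f v)].
exists #|images L|, C, L; split=> // [v|c].
  rewrite card_imset ?cardsT ?card_ord // => a b /eqP.
  by rewrite eq_Tagged => /eqP.
move=> /list_coloringP[cL _] u v cuv.
have /imsetP[a _ ea] := cL u; have /imsetP[b _ eb] := cL v.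
by have := congr1 tag cuv; rewrite ea eb.
Qed.

(** * Rainbow lists on a disjoint union *)

Section ListDunion.
Variables (p : nat) (G : 'I_p -> sgraph) (f : forall i, G i -> nat).

Lemma list_coloring_dunion (C : finType) (L : dunion G -> {set C})
    (c : forall i, G i -> C) :
  (forall i, list_coloring (fun v => L (@inc _ G i v)) (c i)) ->
  list_coloring L (fun x => c (tag x) (tagged x)).
Proof.
move=> cP; apply/list_coloringP; split=> [[i v]|[i u] [j v]].
  by have /list_coloringP[+ _] := cP i; apply.
rewrite /= /dunion_adj /=; case: (eqVneq i j) => //= eij; subst j.
rewrite tagged_asE.
by have /list_coloringP[_] := cP i; apply.
Qed.

(** Tagging colours with their component makes the lists of distinct components disjoint; [comb]
    then glues every colour set of the union from one colour set per component. *)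
Lemma rainbow_lists_dunion (k : 'I_p -> nat) :
  (forall i, rainbow_lists (@f i) (k i)) ->
  rainbow_lists (dunion_fun f) (\prod_i k i).
Proof.
move=> rl.
pose C i := sval (cid (rl i)).
pose L i : G i -> {set C i} := sval (cid (svalP (cid (rl i)))).
have LP i : [/\ forall v, #|L i v| = f v,
    forall c, list_coloring (@L i) c -> injective c & #|images (@L i)| <= k i].
  exact: svalP (cid (svalP (cid (rl i)))).
pose D : finType := {i : 'I_p & C i}.
pose tg i (a : C i) : D := Tagged (fun i => C i) a.
have tg_inj i : injective (@tg i) by move=> a b /eqP; rewrite eq_Tagged => /eqP.
pose LD (x : dunion G) : {set D} := [set tg _ a | a in L (tag x) (tagged x)].
pose comb (T : {dffun forall i, {set C i}}) : {set D} :=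
  [set y : D | tagged y \in T (tag y)].
have key c : list_coloring LD c -> exists2 d : forall i, G i -> C i,
    forall i, list_coloring (@L i) (d i) & forall i v, c (@inc _ G i v) = tg _ (d i v).
  move=> /list_coloringP[cL adjc].
  have exa i v : {a | a \in L i v & c (@inc _ G i v) = tg _ a}.
    by apply: cid2; have /imsetP[a] := cL (@inc _ G i v); exists a.
  pose d i v := s2val (exa i v).
  have cd i v : c (@inc _ G i v) = tg _ (d i v) := s2valP' (exa i v).
  exists d => // i; apply/list_coloringP; split=> [v|u v uv].
    exact: s2valP (exa i v).
  have := adjc (inc u) (inc v); rewrite adj_inc => /(_ uv).
  by rewrite !cd; apply: contraNneq => ->.
exists D, LD; split=> [[i v]|c /key[d dP cd] [i u] [j v]|].
- by rewrite card_imset //; case: (LP i).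
- rewrite -/(inc u) -/(inc v) !cd => e.
  have eij : i = j := congr1 tag e.
  subst j; congr (existT _ _ _).
  by case: (LP i) => _ inj _; apply: (inj _ (dP i)); apply: tg_inj.
apply: (@leq_trans #|[set comb T | T in setXn (fun i => images (@L i))]|).
  apply/subset_leq_card/subsetP => S /imagesP[c /key[d dP cd] ->].
  apply/imsetP; exists (finfun (fun i => [set d i v | v : G i])).
    by apply/setXnP => i; rewrite ffunE; apply/imagesP; exists (d i).
  apply/setP => -[i a]; rewrite inE /= ffunE.
  apply/imsetP/imsetP => [[[j v] _]|[v _ ->]].
    rewrite -/(inc v) cd => e.
    have eij : i = j := congr1 tag e.
    by subst j; exists v => //; apply: tg_inj.
  by exists (inc v); rewrite ?cd.
apply: leq_trans (leq_imset_card _ _) _; rewrite cardsXn.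
by apply: leq_prod => i _; case: (LP i).
Qed.

Lemma rainbow_lists_dunion_leq (m : nat) : rainbow_lists (dunion_fun f) m ->
  exists2 k : 'I_p -> nat, forall i, rainbow_lists (@f i) (k i) & \prod_i k i <= m.
Proof.
move=> [C [L [cardL rainbow le_m]]].
pose Li i (v : G i) := L (inc v).
have cardLi i v : #|Li i v| = f v by rewrite cardL.
have [[i none]|colorable] := pselect (exists i, forall c, ~ list_coloring (@Li i) c).
  have exk j := cid (rainbow_lists_ex (@f j)).
  (* A component without list colourings has no colour set and makes the product 0; the others take
     any admissible value. *)
  exists (fun j => if j == i then 0 else sval (exk j)); last first.
    by rewrite (bigD1 i) //= eqxx.
  move=> j; case: eqP => [->|_]; last exact: svalP (exk j).
  exists C, (@Li i); split=> // [c /none //|].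
  rewrite leqn0 cards_eq0; apply/eqP/setP => S; rewrite inE.
  by apply/imagesP => -[c /none].
have exc i : {c | list_coloring (@Li i) c}.
  apply: cid; apply: contrapT => no; apply: colorable; exists i => c cP.
  by apply: no; exists c.
pose c0 i := sval (exc i).
have c0P i : list_coloring (@Li i) (c0 i) := svalP (exc i).
(* A shared colour would yield a non-injective colouring of the whole union; [c0] colours the
   remaining components. *)
have disj i j c d : i != j -> list_coloring (@Li i) c -> list_coloring (@Li j) d ->
    forall u v, c u <> d v.
  move=> ij cP dP u v cd.
  pose e := dfwith (dfwith c0 c) d.
  have eP l : list_coloring (@Li l) (e l).
    by rewrite /e; case: dfwithP => // l' _; case: dfwithP.
  have ji : j != i by rewrite eq_sym.
  have := rainbow _ (list_coloring_dunion eP) (inc u) (inc v).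
  rewrite /= /e dfwith_in dfwith_out // dfwith_in => /(_ cd) /(congr1 tag) /= eij.
  by rewrite eij eqxx in ij.
exists (fun i => #|images (@Li i)|).
  move=> i; exists C, (@Li i); split=> // c cP u v cuv.
  have eP l : list_coloring (@Li l) (dfwith c0 c l) by case: dfwithP.
  have := rainbow _ (list_coloring_dunion eP) (inc u) (inc v).
  rewrite /= dfwith_in => /(_ cuv) /eqP; rewrite eq_Tagged.
  by move/eqP.
apply: leq_trans le_m; rewrite -cardsXn.
(* Colour sets of distinct components are disjoint, so a family of them is determined by its
   union. *)
pose U (T : {dffun forall i : 'I_p, {set C}}) := \bigcup_i T i.
have sub T T' : T \in setXn (fun i => images (@Li i)) ->
    T' \in setXn (fun i => images (@Li i)) -> U T = U T' ->
    forall i, T i \subset T' i.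
  move=> /setXnP TX /setXnP TX' eU i; apply/subsetP => a aT.
  have : a \in U T' by rewrite -eU; apply/bigcupP; exists i.
  case/bigcupP => j _; have [<- //|ij] := eqVneq i j.
  have /imagesP[c cP eT] := TX i; have /imagesP[d dP ->] := TX' j.
  case/imsetP => v _ av; move: aT; rewrite eT => /imsetP[u _ au].
  by case: (disj i j c d ij cP dP u v); rewrite -au.
rewrite -(@card_in_imset _ _ U); last first.
  move=> T T' TX TX' eU; apply/ffunP => i; apply/eqP.
  by rewrite eqEsubset !sub.
(* Each such union is the colour set of a colouring combined from the components. *)
apply/subset_leq_card/subsetP => S /imsetP[T /setXnP TX ->].
have exd i : {c | list_coloring (@Li i) c & T i = [set c v | v : G i]}.
  by apply: cid2; apply/imagesP.
pose d i := s2val (exd i).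
have dP i : list_coloring (@Li i) (d i) := s2valP (exd i).
apply/imagesP; exists (fun x : dunion G => d (tag x) (tagged x)).
  exact: list_coloring_dunion.
apply/setP => a; apply/bigcupP/imsetP => [[i _]|[[i v] _ ->]].
  by rewrite (s2valP' (exd i)) => /imsetP[v _ ->]; exists (inc v).
by exists i => //; rewrite (s2valP' (exd i)); apply: imset_f.
Qed.

Lemma m_c_dunion :
  m_c (G := dunion G) (dunion_fun f) =
    \big[emul/Some 1]_(i < p) m_c (G := G i) (@f i).
Proof.
have rainbowP (H : sgraph) (g : H -> nat) m :
    ~ choosable (extend g (m := m)) <-> rainbow_lists g m.
  by split; [apply: not_choosable_rainbow | apply: rainbow_not_choosable].
rewrite /m_c; under [RHS]eq_bigr => i _ do rewrite (eq_emin (rainbowP _ (@f i))).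
rewrite (eq_emin (rainbowP _ (dunion_fun f))).
apply: emin_prod => [i||m].
- exact: rainbow_lists_ex.
- exact: rainbow_lists_dunion.
- exact: rainbow_lists_dunion_leq.
Qed.

End ListDunion.

Theorem theorem8 (p : nat) (hp : 0 < p) (G : 'I_p -> sgraph)
    (f : forall i : 'I_p, G i -> nat)
    (hf : forall (i : 'I_p) (v : G i), 0 < f i v) :
  m_c (G := dunion G) (dunion_fun f) =
    \big[emul/Some 1]_(i < p) m_c (G := G i) (f i)
  /\
  m_p (G := dunion G) (dunion_fun f) =
    \big[emul/Some 1]_(i < p) m_p (G := G i) (f i).
Proof. by split; [apply: m_c_dunion | apply: m_p_dunion]. Qed.
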